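(* Let $N\geq 2$, $R>0$, let $B_R\subset\mathbb{R}^N$ be the ball of radius $R$ centred at the origin, let $f:\mathbb{R}^N\times\mathbb{R}\to\mathbb{R}$ be a smooth positive function, and let $u$ be a smooth positive radial solution of $$\begin{cases}\Delta^2 u=f(x,u) & \text{in } B_R,\\ u=0 & \text{on }\partial B_R.\end{cases}$$ Then $u$ is strictly radially decreasing.
   Context: No second boundary condition is prescribed on $\partial B_R$. The solution $u$ is smooth up to the boundary, and ''positive'' means $u>0$ in $B_R$. ''Strictly radially decreasing'' means that, writing $u(x)=u(r)$ with $r=|x|$, the function $r\mapsto u(r)$ is strictly decreasing on $[0,R]$. *)

(* Defs.v *)
From mathcomp Require Import all_boot all_order all_algebra.
From mathcomp Require Import all_classical all_reals all_analysis.

Set Implicit Arguments.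
Unset Strict Implicit.
Unset Printing Implicit Defensive.

Import Order.TTheory GRing.Theory Num.Theory.
Import numFieldNormedType.Exports.

Local Open Scope classical_set_scope.
Local Open Scope ring_scope.

(* The library norm on 'rV_N is the sup norm, hence the Euclidean norm is
   introduced separately; both induce the same topology. *)
Definition enorm (R : realType) (N : nat) (x : 'rV[R]_N) : R :=
  Num.sqrt (\sum_(i < N) x 0 i ^+ 2).

Definition eball (R : realType) (N : nat) (r : R) : set 'rV[R]_N :=
  [set x | enorm x < r].

Definition esphere (R : realType) (N : nat) (r : R) : set 'rV[R]_N :=
  [set x | enorm x = r].

(* iter_derive [:: v1; ...; vk] f = D_v1 (... (D_vk f)); in finite dimension,
   taking arbitrary directions amounts to taking all iterated partial
   derivatives. *)
Definition iter_derive (R : realType) (V : normedModType R) (vs : seq V)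
    (f : V -> R) : V -> R :=
  foldr (fun v g => 'D_v g) f vs.

Definition smooth_on (R : realType) (V : normedModType R) (A : set V)
    (f : V -> R) : Prop :=
  forall (vs : seq V) (x : V), A x ->
    {for x, continuous (iter_derive vs f)} /\
    (forall v : V, derivable (iter_derive vs f) x v).

(* f is C^oo on the open set A, and f and all its derivatives on A extend
   continuously to the closure of A; f itself is continuous up to the boundary,
   so that its boundary values are those of its extension. The values of f
   outside closure A are irrelevant. *)
Definition smooth_up_to_boundary (R : realType) (V : normedModType R)
    (A : set V) (f : V -> R) : Prop :=
  [/\ smooth_on A f,
      {within closure A, continuous f} &
      forall vs : seq V, exists2 g : V -> R,
        {within closure A, continuous g} &
        forall x, A x -> g x = iter_derive vs f x].

Definition laplacian (R : realType) (N : nat) (u : 'rV[R]_N -> R) :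
    'rV[R]_N -> R :=
  fun x => \sum_(i < N) 'D_(delta_mx 0 i) ('D_(delta_mx 0 i) u) x.

Definition radial_profile (R : realType) (N : nat) (r : R) (u : 'rV[R]_N -> R)
    (w : R -> R) : Prop :=
  forall x : 'rV[R]_N, enorm x <= r -> u x = w (enorm x).

Definition radial (R : realType) (N : nat) (r : R) (u : 'rV[R]_N -> R) : Prop :=
  exists w : R -> R, radial_profile r u w.

Definition strictly_radially_decreasing (R : realType) (N : nat) (r : R)
    (u : 'rV[R]_N -> R) : Prop :=
  exists2 w : R -> R, radial_profile r u w &
    forall s t : R, 0 <= s -> s < t -> t <= r -> w t < w s.

(* Main.v *)
(* Along a radial smooth function g, an interior local maximum (minimum) of the
   profile s |-> g (s e) forces laplacian g <= 0 (>= 0) there, by the second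
   derivative test. The function v := laplacian u is again radial and
   laplacian v > 0, so its profile has no interior local maximum and is strictly
   increasing. Suppose u (s e) <= u (t e) with s < t < rho. Since u > 0 inside
   and u = 0 on the sphere, u has a maximum over [s, rho] at some d in
   ]s, rho[, whence v (d e) <= 0 and v < 0 before d; thus the profile of u has
   no local minimum before d and is strictly decreasing on [0, d], which
   contradicts the choice of d. *)

Require Import Defs.
From mathcomp Require Import all_boot all_order all_algebra.
From mathcomp Require Import all_classical all_reals all_analysis.
From mathcomp Require Import ring lra.

Import Order.TTheory GRing.Theory Num.Theory.
Import numFieldNormedType.Exports.

Local Open Scope classical_set_scope.
Local Open Scope ring_scope.

(** * Restriction to lines and the second derivative test in one variable *)

Lemma is_derive_line {R : realType} {V : normedModType R} (f : V -> R)
    (x v : V) (s d : R) :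
  is_derive (s *: v + x) v f d <->
  is_derive s 1 (fun t : R => f (t *: v + x)) d.
Proof.
(* Since [(h + s) v + x = h v + (s v + x)], both sides have the same difference quotient, so
   differentiability and the value transfer together. *)
have E : (fun h : R => h^-1 *: ((f \o shift (s *: v + x)) (h *: v) - f (s *: v + x)))
   = (fun h : R => h^-1 *: (((fun t : R => f (t *: v + x)) \o shift s) (h *: 1) -
       f (s *: v + x))).
  by apply/funext => h /=; rewrite scalerDl [h *: 1]mulr1 addrA.
by split=> -[D L]; split; [move: D|move: L|move: D|move: L];
  rewrite /derivable /derive E.
Qed.

Lemma is_derive_line0 {R : realType} {V : normedModType R} (f : V -> R)
    (x v : V) (d : R) :
  is_derive x v f d <-> is_derive (0 : R) 1 (fun t : R => f (t *: v + x)) d.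
Proof. by rewrite -is_derive_line scale0r add0r. Qed.

Lemma near_line {R : realType} {V : normedModType R} {P : V -> Prop}
    {x : V} (v : V) :
  (\forall y \near x, P y) -> \forall t \near (0 : R), P (t *: v + x).
Proof.
move=> Px; have : (t *: v + x) @[t --> (0 : R)] --> x.
  rewrite -[X in _ --> X]add0r -[in X in _ --> X](scale0r v).
  by apply: cvgD; [apply: cvgZr_tmp; exact: cvg_id|exact: cvg_cst].
by move=> /(_ _ Px).
Qed.

(** At the maximum [phi1 0 = 0]. If [d > 0], then [phi1] is positive just to the right of [0], and
    the mean value theorem yields a point [b] with [phi b > phi 0]. *)
Lemma second_derivative_le0 {R : realType} (phi phi1 : R -> R) (d : R) :
  (\forall t \near (0 : R), is_derive (t : R) 1 phi (phi1 t) /\ phi t <= phi 0) ->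
  is_derive (0 : R) 1 phi1 d -> d <= 0.
Proof.
move=> /nbhs_ballP[e /= e0 He] [D1 D1v].
have He' t : `|t| < e -> is_derive (t : R) 1 phi (phi1 t) /\ phi t <= phi 0.
  by move=> te; apply: He; rewrite /ball /= sub0r normrN.
have phi10 : phi1 0 = 0.
  have [d0 _] := He' 0 ltac:(by rewrite normr0).
  have : is_derive (0 : R) 1 phi 0.
    apply: (@derive1_at_max _ _ (- e) e).
    - by rewrite -subr_ge0 opprK; lra.
    - by move=> t; rewrite in_itv /= -ltr_norml => /He'[[]].
    - by rewrite in_itv /= oppr_lt0 e0.
    - by move=> t; rewrite in_itv /= -ltr_norml => /He'[].
  by move=> [_ d1]; case: d0 => _; rewrite d1.
rewrite leNgt; apply/negP => dgt0.
have : \forall h \near (0 : R)^', 0 < h^-1 *: ((phi1 \o shift 0) (h *: 1) - phi1 0).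
  apply: (cvgr_gt d) => //; rewrite -D1v; exact: D1.
move=> /nbhs_ballP[r /= r0 Hr].
(* Halving puts [b] strictly below both radii: [e] for the hypotheses on [phi], [r] for the sign of
   the quotient [phi1 h / h]. *)
pose b := Num.min e r / 2.
have b0 : 0 < b by rewrite /b divr_gt0 // lt_min e0 r0.
have mine : Num.min e r <= e by rewrite ge_min lexx.
have minr : Num.min e r <= r by rewrite ge_min lexx orbT.
have [be br] : b < e /\ b < r by rewrite /b in b0 *; split; lra.
have [||c] := @MVT R phi phi1 0 b b0.
- move=> x; rewrite in_itv /= => /andP[x0 xb].
  by apply: (He' x _).1; rewrite gtr0_norm //; lra.
- apply: derivable_within_continuous => x; rewrite in_itv /= => /andP[x0 xb].
  have [|[]//] := He' x; rewrite ger0_norm //; lra.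
- rewrite in_itv /= => /andP[c0 cb] E.
  have [|_] := He' b; first by rewrite gtr0_norm.
  rewrite leNgt => /negP; apply; rewrite -subr_gt0 E subr0 mulr_gt0 //.
  have := Hr c; rewrite /ball /= sub0r normrN gtr0_norm // addr0 [c *: 1]mulr1.
  rewrite phi10 subr0 => /(_ ltac:(lra)); rewrite gt_eqF // => /(_ isT).
  by rewrite [_ *: _]mulrC pmulr_lgt0 // invr_gt0.
Qed.

(** * Smooth functions on open sets and their second derivatives at extrema *)

Section Smooth.
Context {R : realType} {V : normedModType R}.
Implicit Types (A : set V) (f : V -> R).

Lemma near_open {A x} : open A -> A x -> nbhs x A.
Proof. by move=> oA Ax; apply: open_nbhs_nbhs; split. Qed.

Lemma smooth_on_derive {A f} (v : V) : smooth_on A f -> smooth_on A ('D_v f).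
Proof.
(* [iter_derive] applies the last direction of the list first, so the derivative along [v] is
   absorbed by appending [v]. *)
by move=> sf vs x Ax; have := sf (rcons vs v) x Ax; rewrite /iter_derive foldr_rcons.
Qed.

Lemma smooth_on_derivable {A f x} (v : V) :
  smooth_on A f -> A x -> is_derive x v f ('D_v f x).
Proof. by move=> sf Ax; apply: derivableP; exact: (sf [::] x Ax).2. Qed.

(** The induction step differentiates the identity, so it must hold on a neighbourhood of [x];
    openness of [A] supplies one. *)
Lemma iter_derive_sum {n : nat} {A} {f : 'I_n -> V -> R} (vs : seq V) (x : V) :
  open A -> (forall i, smooth_on A (f i)) -> A x ->
  iter_derive vs (fun y => \sum_(i < n) f i y) x =
  \sum_(i < n) iter_derive vs (f i) x.
Proof.
move=> oA sf; elim: vs x => [//|v vs IH] x Ax /=.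
have near_IH : \forall y \near x,
    iter_derive vs (fun z => \sum_(i < n) f i z) y =
    (\sum_(i < n) iter_derive vs (f i)) y.
  by apply: filterS (near_open oA Ax) => y Ay; rewrite fct_sumE; exact: IH Ay.
rewrite [LHS](near_eq_derive _ near_IH) derive_sum // => i.
exact: (sf i vs x Ax).2.
Qed.

Lemma smooth_on_sum {n : nat} {A} {f : 'I_n -> V -> R} :
  open A -> (forall i, smooth_on A (f i)) ->
  smooth_on A (fun y => \sum_(i < n) f i y).
Proof.
move=> oA sf vs x Ax.
have E : \forall y \near x, (\sum_(i < n) iter_derive vs (f i)) y =
    iter_derive vs (fun z => \sum_(i < n) f i z) y.
  apply: filterS (near_open oA Ax) => y Ay.
  by rewrite fct_sumE; apply/esym; exact: iter_derive_sum oA sf Ay.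
split=> [|v].
- rewrite /prop_for /continuous_at -(nbhs_singleton E).
  apply: cvg_trans; first exact: (near_eq_cvg E).
  by rewrite fct_sumE; apply: cvg_big => [|i _];
    [exact: add_continuous|exact: (sf i vs x Ax).1].
- apply: (near_eq_derivable E); apply: derivable_sum => i.
  exact: (sf i vs x Ax).2.
Qed.

Lemma derive2_local_max {A f x} (v : V) : open A -> smooth_on A f -> A x ->
  (\forall y \near x, f y <= f x) -> 'D_v ('D_v f) x <= 0.
Proof.
move=> oA sf Ax fx.
apply: (@second_derivative_le0 _ (fun t => f (t *: v + x))
  (fun t => 'D_v f (t *: v + x))).
- have tA := @near_line _ _ A x v (near_open oA Ax).
  apply: filterS2 tA (near_line v fx) => t At ft.
  rewrite scale0r add0r; split=> //.
  exact: (is_derive_line f x v t _).1 (smooth_on_derivable v sf At).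
- exact: (is_derive_line0 _ x v _).1
    (smooth_on_derivable v (smooth_on_derive v sf) Ax).
Qed.

Lemma derive2_local_min {A f x} (v : V) : open A -> smooth_on A f -> A x ->
  (\forall y \near x, f x <= f y) -> 0 <= 'D_v ('D_v f) x.
Proof.
move=> oA sf Ax fx; rewrite -oppr_le0.
apply: (@second_derivative_le0 _ (fun t => - f (t *: v + x))
  (fun t => - 'D_v f (t *: v + x))).
- have tA := @near_line _ _ A x v (near_open oA Ax).
  apply: filterS2 tA (near_line v fx) => t At ft.
  rewrite scale0r add0r lerN2; split=> //; apply: is_deriveN.
  exact: (is_derive_line f x v t _).1 (smooth_on_derivable v sf At).
- apply: is_deriveN.
  exact: (is_derive_line0 _ x v _).1
    (smooth_on_derivable v (smooth_on_derive v sf) Ax).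
Qed.

End Smooth.

(** * Sign of the Laplacian at local extrema *)

Section Laplacian.
Context {R : realType} {N : nat} {A : set 'rV[R]_N} {u : 'rV[R]_N -> R}.
Hypotheses (oA : open A) (u_smooth : smooth_on A u).

Lemma laplacian_smooth : smooth_on A (laplacian u).
Proof.
pose D i : 'rV[R]_N -> R := 'D_(delta_mx 0 i) ('D_(delta_mx 0 i) u).
apply: (smooth_on_sum (f := D) oA) => i.
exact: smooth_on_derive (smooth_on_derive _ u_smooth).
Qed.

Lemma laplacian_local_max {x : 'rV[R]_N} : A x ->
  (\forall y \near x, u y <= u x) -> laplacian u x <= 0.
Proof.
move=> Ax ux; apply: sumr_le0 => i _.
exact: derive2_local_max oA u_smooth Ax ux.
Qed.

Lemma laplacian_local_min {x : 'rV[R]_N} : A x ->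
  (\forall y \near x, u x <= u y) -> 0 <= laplacian u x.
Proof.
move=> Ax ux; apply: sumr_ge0 => i _.
exact: derive2_local_min oA u_smooth Ax ux.
Qed.

End Laplacian.

(** * The Euclidean norm, its balls and the coordinate axes *)

Section EuclideanNorm.
Context {R : realType} {N : nat}.
Implicit Types (x : 'rV[R]_N) (r : R).

Lemma enorm_ge0 x : 0 <= enorm x.
Proof. exact: sqrtr_ge0. Qed.

Lemma enorm_sqr x : enorm x ^+ 2 = \sum_(i < N) x 0 i ^+ 2.
Proof. by rewrite sqr_sqrtr // sumr_ge0 // => i _; exact: sqr_ge0. Qed.

Lemma enorm_eq0 x : enorm x = 0 -> x = 0.
Proof.
move=> x0; have /eqP := enorm_sqr x.
rewrite x0 expr0n /= eq_sym psumr_eq0; last first.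
  by move=> i _; exact: sqr_ge0.
move=> /allP xi0; apply/rowP => i; rewrite mxE; apply/eqP.
by have := xi0 i; rewrite mem_index_enum sqrf_eq0 => /(_ isT).
Qed.

(** Only coordinate [i] moves, so along a coordinate line the squared norm is a quadratic polynomial
    in [t], differentiable even through the origin. *)
Lemma enorm_sqr_shift x (i : 'I_N) (t : R) :
  enorm (t *: delta_mx 0 i + x) ^+ 2 = enorm x ^+ 2 + 2 * x 0 i * t + t ^+ 2.
Proof.
rewrite !enorm_sqr (bigD1 i) //= [in RHS](bigD1 i) //= !mxE !eqxx /=.
under eq_bigr => j ji do rewrite !mxE (negbTE ji) andbF mulr0 add0r.
by ring.
Qed.

Lemma enorm_axis (i : 'I_N) (s : R) :
  0 <= s -> enorm (s *: delta_mx 0 i : 'rV[R]_N) = s.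
Proof.
move=> s0; apply/eqP; rewrite -(@eqrXn2 _ 2) // ?enorm_ge0 //.
rewrite -[_ *: _]addr0 enorm_sqr_shift mxE mulr0 mul0r addr0.
by rewrite enorm_sqr big1 ?add0r // => j _; rewrite mxE expr0n.
Qed.

Lemma enorm_continuous : continuous (@enorm R N).
Proof.
have cs : continuous (fun x : 'rV[R]_N => \sum_(i < N) x 0 i ^+ 2).
  apply: continuous_big => [|i _ x]; first exact: add_continuous.
  under eq_fun do rewrite expr2.
  by apply: (@continuousM _ _ (fun y : 'rV[R]_N => y 0 i)) => ?;
    exact: coord_continuous.
by move=> x; apply: continuous_comp; [exact: cs|exact: sqrt_continuous].
Qed.

Lemma eball_open r : open (@eball R N r).
Proof.
rewrite (_ : eball r = (@enorm R N) @^-1` [set t | t < r]) //.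
by apply: open_comp; [move=> x _; exact: enorm_continuous|exact: open_lt].
Qed.

Lemma eball_axis (i : 'I_N) {r s : R} :
  0 <= s -> s < r -> eball r (s *: delta_mx 0 i : 'rV[R]_N).
Proof. by move=> s0 sr; rewrite /eball /= enorm_axis. Qed.

End EuclideanNorm.

(** * The Laplacian of a radial function is radial *)

Section Radial.
Context {R : realType} {N : nat} (i0 : 'I_N) {r : R} {u : 'rV[R]_N -> R}.
Notation e := (delta_mx 0 i0 : 'rV[R]_N).
Hypotheses (u_smooth : smooth_on (eball r) u)
  (u_radial : forall x, eball r x -> u x = u (enorm x *: e)).

Lemma is_derive_axis {g : 'rV[R]_N -> R} {s : R} :
  smooth_on (eball r) g -> 0 <= s -> s < r ->
  is_derive s 1 (fun t : R => g (t *: e)) ('D_e g (s *: e)).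
Proof.
move=> sg s0 sr; have := smooth_on_derivable e sg (eball_axis i0 s0 sr).
rewrite -{1}[s *: e]addr0 => /is_derive_line.
by under eq_fun do rewrite addr0.
Qed.

(** [G1] and [G2] are the first two derivatives of [G(q) = u (sqrt q e)], the profile in the
    variable [q = |x|^2]. The chain rule applies for [q > 0], where the square root is
    differentiable. *)
Lemma sqr_profile_derivatives : exists G1 G2 : R -> R,
  forall q : R, 0 < q -> q < r ^+ 2 -> 0 < r ->
    is_derive q 1 (fun p : R => u (Num.sqrt p *: e)) (G1 q) /\
    is_derive q 1 G1 (G2 q).
Proof.
pose G1 (q : R) := 'D_e u (Num.sqrt q *: e) * (2 * Num.sqrt q)^-1.
exists G1, ('D_1 G1) => q q0 qr r0.
have sq0 : 0 < Num.sqrt q by rewrite sqrtr_gt0.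
have sqr : Num.sqrt q < r.
  by rewrite -(@ltr_pXn2r _ 2) ?nnegrE ?(ltW sq0) ?(ltW r0) // sqr_sqrtr // ltW.
have dsq := is_derive1_sqrt q0.
split.
  exact: (@is_derive1_comp _ (fun s : R => u (s *: e)) _ _ _ _
    (is_derive_axis u_smooth (ltW sq0) sqr) dsq).
apply: derivableP; rewrite /G1; apply: derivableM.
  apply: ex_derive.
  exact: (@is_derive1_comp _ (fun s : R => 'D_e u (s *: e)) _ _ _ _
    (is_derive_axis (smooth_on_derive e u_smooth) (ltW sq0) sqr) dsq).
apply: derivableV; first by rewrite mulf_neq0 // gt_eqF.
by apply: derivableM; [exact: derivable_cst|exact: ex_derive].
Qed.

Lemma is_derive_radial {g : R -> R} {d : R} {x : 'rV[R]_N} (i : 'I_N) :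
  is_derive (enorm x ^+ 2) 1 g d ->
  is_derive x (delta_mx 0 i) (fun y => g (enorm y ^+ 2)) (2 * x 0 i * d).
Proof.
move=> gd; apply: (is_derive_line0 _ _ _ _).2.
under eq_fun do rewrite enorm_sqr_shift.
pose p (t : R) : R := enorm x ^+ 2 + 2 * x 0 i * t + t ^+ 2.
have p0 : p 0 = enorm x ^+ 2 by rewrite /p mulr0 expr0n /= !addr0.
have dp : is_derive (0 : R) 1 p (2 * x 0 i).
  by apply: is_derive_eq; rewrite add0r mul1r ![_%:A]mulr1 !addr0.
rewrite [_ * d]mulrC; apply: (@is_derive1_comp _ g p) => //.
by rewrite p0.
Qed.

Lemma punctured_eball_open : open [set x : 'rV[R]_N | 0 < enorm x < r].
Proof.
rewrite (_ : mkset _ = (@enorm R N) @^-1` `]0, r[); last first.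
  by apply/seteqP; split=> x /=; rewrite in_itv.
by apply: open_comp => [x _|]; [exact: enorm_continuous|exact: itv_open].
Qed.

Lemma is_derive_coord (x : 'rV[R]_N) (i : 'I_N) :
  is_derive x (delta_mx 0 i) (fun y => y 0 i) 1.
Proof.
apply: (is_derive_line0 _ _ _ _).2.
under eq_fun do rewrite !mxE !eqxx mulr1.
by apply: is_derive_eq; rewrite addr0.
Qed.

(* With u = G(|x|^2), the inner function is quadratic, so no singularity of
   |x| enters: D_i u = 2 x_i G' and D_i D_i u = 2 G' + 4 x_i^2 G''. *)
Lemma laplacian_radial (x : 'rV[R]_N) :
  eball r x -> laplacian u x = laplacian u (enorm x *: e).
Proof.
move=> xr; have [x0|] := ltP 0 (enorm x); last first.
  (* At the centre both points are the origin; the formula below is available only for [|x| > 0]. *)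
  move=> x0; have /enorm_eq0 -> : enorm x = 0.
    by apply/eqP; rewrite eq_le x0 enorm_ge0.
  suff -> : enorm (0 : 'rV[R]_N) = 0 by rewrite scale0r.
  by rewrite -(scale0r e) enorm_axis.
have [G1 [G2 HG]] := sqr_profile_derivatives.
have {}HG (y : 'rV[R]_N) : 0 < enorm y < r ->
    is_derive (enorm y ^+ 2) 1 (fun p : R => u (Num.sqrt p *: e))
      (G1 (enorm y ^+ 2)) /\
    is_derive (enorm y ^+ 2) 1 G1 (G2 (enorm y ^+ 2)).
  move=> /andP[y0 yr]; apply: HG; rewrite ?exprn_gt0 //; last exact: lt_trans yr.
  by rewrite ltr_pXn2r // nnegrE ltW // (lt_trans y0).
have nearP y : 0 < enorm y < r -> nbhs y [set z : 'rV[R]_N | 0 < enorm z < r].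
  exact: near_open punctured_eball_open.
have D1 i y : 0 < enorm y < r ->
    is_derive y (delta_mx 0 i) u (2 * y 0 i * G1 (enorm y ^+ 2)).
  move=> yr; have [Gy _] := HG y yr.
  apply: near_eq_is_derive (is_derive_radial i Gy).
  apply: filterS (nearP y yr) => z /andP[z0 zr].
  by rewrite sqrtr_sqr ger0_norm ?enorm_ge0 // -u_radial.
have D2 i y : 0 < enorm y < r -> 'D_(delta_mx 0 i) ('D_(delta_mx 0 i) u) y =
    2 * G1 (enorm y ^+ 2) + 4 * y 0 i ^+ 2 * G2 (enorm y ^+ 2).
  move=> yr; have [_ G1y] := HG y yr.
  have dc := is_deriveZ 2 (is_derive_coord y i).
  have dM := is_deriveM dc (is_derive_radial i G1y).
  (* The first-order formula holds on a whole neighbourhood of [y], so the derivative of the product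
     is that of [D_i u]. *)
  have DE : \forall z \near y, ((2 \*: (fun z : 'rV[R]_N => z 0 i)) *
      (fun z => G1 (enorm z ^+ 2))) z = 'D_(delta_mx 0 i) u z.
    by apply: filterS (nearP y yr) => z zr; case: (D1 i z zr) => _ ->.
  case: (near_eq_is_derive DE dM) => _ ->.
  by rewrite /= /GRing.scale /=; ring.
(* Summing over [i] turns the [y_i^2] into [|y|^2], so the Laplacian depends on [|y|] alone. *)
have lapE y : 0 < enorm y < r -> laplacian u y =
    N%:R * (2 * G1 (enorm y ^+ 2)) + 4 * enorm y ^+ 2 * G2 (enorm y ^+ 2).
  move=> yr; rewrite /laplacian (eq_bigr _ (fun i _ => D2 i y yr)) big_split /=.
  rewrite sumr_const card_ord [N%:R * _]mulr_natl.
  by rewrite -mulr_suml -mulr_sumr -enorm_sqr.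
by rewrite !lapE ?enorm_axis ?enorm_ge0 ?x0.
Qed.

End Radial.

(** * Continuity along an axis up to the boundary sphere *)

Lemma axis_continuous {R : realType} {N : nat} (i : 'I_N) (s : R) :
  t *: (delta_mx 0 i : 'rV[R]_N) @[t --> s] --> s *: delta_mx 0 i.
Proof. by apply: cvgZr_tmp; exact: cvg_id. Qed.

Lemma closure_eball_axis {R : realType} {N : nat} (i : 'I_N) {r s : R} :
  0 < r -> 0 <= s -> s <= r ->
  closure (eball r) (s *: delta_mx 0 i : 'rV[R]_N).
Proof.
move=> r0 s0; rewrite le_eqVlt => /predU1P[->|sr]; last first.
  exact/subset_closure/eball_axis.
move=> B /(axis_continuous i r) rB.
(* A neighbourhood [B] of the boundary point [r e] meets the ball at [t e] for [t] slightly below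
   [r]. *)
suff : \forall t \near r^'-, (eball r `&` B) (t *: (delta_mx 0 i : 'rV[R]_N)).
  by move=> /filter_ex[t Bt]; exists (t *: delta_mx 0 i).
near=> t; split.
  by apply: eball_axis; near: t; [exact: nbhs_left_ge|exact: nbhs_left_lt].
by near: t; exact: cvg_within.
Unshelve. all: by end_near. Qed.

Lemma axis_within_continuous {R : realType} {N : nat} (i : 'I_N) {r a : R}
    {g : 'rV[R]_N -> R} :
  0 < r -> 0 <= a -> {within closure (eball r), continuous g} ->
  {within `[a, r], continuous (fun t : R => g (t *: delta_mx 0 i))}.
Proof.
move=> r0 a0 /subspace_continuousP cg; apply/subspace_continuousP => s /=.
rewrite in_itv /= => /andP[sa sr].
have cs := closure_eball_axis i r0 (le_trans a0 sa) sr.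
apply: (@cvg_comp _ _ _ (fun t : R => t *: delta_mx 0 i) g _ _ _ _ (cg _ cs)).
move=> W /(axis_continuous i s) sW.
have {}sW : \forall t \near s, closure (eball r) (t *: (delta_mx 0 i : 'rV[R]_N)) ->
  W (t *: delta_mx 0 i) by [].
suff : \forall t \near s, [set` `[a, r]] t -> W (t *: delta_mx 0 i) by [].
apply: filterS sW => t tW; rewrite /= in_itv /= => /andP[at_ tr]; apply: tW.
by apply: (closure_eball_axis i r0 _ tr); exact: le_trans at_.
Qed.

(** * A maximum principle for profiles of radial functions *)

Section RadialExtrema.
Context {R : realType} {N : nat} (i0 : 'I_N) {r : R} {g : 'rV[R]_N -> R}.
Notation e := (delta_mx 0 i0 : 'rV[R]_N).
Hypotheses (g_smooth : smooth_on (eball r) g)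
  (g_radial : forall x, eball r x -> g x = g (enorm x *: e)).

(** By continuity of [enorm], points near [s e] have norm near [s]. Norms are nonnegative, so only
    [t >= 0] needs testing; this lets the centre [s = 0] count as an interior point. *)
Lemma near_radial (P : R -> Prop) (s : R) : 0 <= s -> s < r ->
  (\forall t \near s, 0 <= t -> P (g (t *: e))) ->
  \forall y \near s *: e, P (g y).
Proof.
move=> s0 sr Ps; have nb := near_open (eball_open r) (eball_axis i0 s0 sr).
have Py : \forall y \near s *: e, 0 <= enorm y -> P (g (enorm y *: e)).
  have := @enorm_continuous R N (s *: e).
  by rewrite /continuous_at enorm_axis // => /(_ _ Ps).
apply: filterS2 nb Py => y yr; rewrite -g_radial //; apply.
exact: enorm_ge0.
Qed.

Lemma laplacian_profile_max (s : R) : 0 <= s -> s < r ->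
  (\forall t \near s, 0 <= t -> g (t *: e) <= g (s *: e)) ->
  laplacian g (s *: e) <= 0.
Proof.
move=> s0 sr gs.
apply: (laplacian_local_max (eball_open r) g_smooth (eball_axis i0 s0 sr)).
exact: (near_radial (fun z => z <= g (s *: e))).
Qed.

Lemma laplacian_profile_min (s : R) : 0 <= s -> s < r ->
  (\forall t \near s, 0 <= t -> g (s *: e) <= g (t *: e)) ->
  0 <= laplacian g (s *: e).
Proof.
move=> s0 sr gs.
apply: (laplacian_local_min (eball_open r) g_smooth (eball_axis i0 s0 sr)).
exact: (near_radial (fun z => g (s *: e) <= z)).
Qed.

Lemma profile_within_continuous (b : R) : b < r ->
  {within `[0, b], continuous (fun t : R => g (t *: e))}.
Proof.
move=> br; apply: derivable_within_continuous => t.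
rewrite in_itv /= => /andP[t0 tb].
by apply: ex_derive; apply: is_derive_axis g_smooth t0 (le_lt_trans tb br).
Qed.

(** A maximum over [[0, t]] attained before [t], the centre included, would force a nonpositive
    Laplacian there. Hence it is attained at [t] only, which gives strictness. *)
Lemma subharmonic_profile_incr (s t : R) : 0 <= s -> s < t -> t < r ->
  (forall p : R, 0 <= p -> p < t -> 0 < laplacian g (p *: e)) ->
  g (s *: e) < g (t *: e).
Proof.
move=> s0 st tr lap_gt0; have t0 := le_lt_trans s0 st.
have [c] := EVT_max (ltW t0) (profile_within_continuous _ tr).
rewrite in_itv /= => /andP[c0 ct] cmax.
(* Stated for every point with the maximal value: at [c] it yields [c = t], and at [s] it yields the
   strict inequality. *)
have no_max p : 0 <= p -> p < t -> ~ g (p *: e) = g (c *: e).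
  move=> p0 pt pc; have := lap_gt0 p p0 pt; rewrite ltNge => /negP; apply.
  apply: laplacian_profile_max p0 (lt_trans pt tr) _.
  near=> q => q0; rewrite pc; apply: cmax; rewrite in_itv /= q0 ltW //.
  by near: q; exact: lt_nbhsl.
have ctE : c = t.
  by apply/eqP; rewrite eq_le ct leNgt; apply/negP => /(no_max _ c0); apply.
rewrite -ctE lt_neqAle cmax ?in_itv /= ?s0 ?(ltW st) // andbT.
by apply/eqP; exact: no_max.
Unshelve. all: by end_near. Qed.

(** Mirror argument with a minimum over [[0, t]], which can only be attained at [t]. *)
Lemma superharmonic_profile_decr (s t : R) : 0 <= s -> s < t -> t < r ->
  (forall p : R, 0 <= p -> p < t -> laplacian g (p *: e) < 0) ->
  g (t *: e) < g (s *: e).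
Proof.
move=> s0 st tr lap_lt0; have t0 := le_lt_trans s0 st.
have [c] := EVT_min (ltW t0) (profile_within_continuous _ tr).
rewrite in_itv /= => /andP[c0 ct] cmin.
have no_min p : 0 <= p -> p < t -> ~ g (p *: e) = g (c *: e).
  move=> p0 pt pc; have := lap_lt0 p p0 pt; rewrite ltNge => /negP; apply.
  apply: laplacian_profile_min p0 (lt_trans pt tr) _.
  near=> q => q0; rewrite pc; apply: cmin; rewrite in_itv /= q0 ltW //.
  by near: q; exact: lt_nbhsl.
have ctE : c = t.
  by apply/eqP; rewrite eq_le ct leNgt; apply/negP => /(no_min _ c0); apply.
rewrite -ctE lt_neqAle cmin ?in_itv /= ?s0 ?(ltW st) // andbT eq_sym.
by apply/eqP; exact: no_min.
Unshelve. all: by end_near. Qed.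

End RadialExtrema.

Theorem proposition1p1 (R : realType) (N : nat) (hN : (2 <= N)%N)
    (rho : R) (hrho : 0 < rho)
    (f : 'rV[R]_N * R -> R)
    (f_smooth : smooth_on [set: 'rV[R]_N * R] f)
    (f_pos : forall z : 'rV[R]_N * R, 0 < f z)
    (u : 'rV[R]_N -> R)
    (u_smooth : smooth_up_to_boundary (eball rho) u)
    (u_pos : forall x : 'rV[R]_N, eball rho x -> 0 < u x)
    (u_radial : radial rho u)
    (u_eq : forall x : 'rV[R]_N, eball rho x ->
      laplacian (laplacian u) x = f (x, u x))
    (u_bd : forall x : 'rV[R]_N, esphere rho x -> u x = 0) :
  strictly_radially_decreasing rho u.
Proof.
have i0 : 'I_N by exact: Ordinal (ltnW hN).
pose e : 'rV[R]_N := delta_mx 0 i0.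
case: u_smooth => us uc _; case: u_radial => w uw.
have wE s : 0 <= s -> s <= rho -> w s = u (s *: e).
  by move=> s0 sr; rewrite uw enorm_axis.
exists w => // s t s0 st tr; have t0 := le_lt_trans s0 st.
rewrite !wE ?(ltW t0) ?(ltW (lt_le_trans st tr)) //.
have ur x : eball rho x -> u x = u (enorm x *: e).
  by move=> /ltW xr; rewrite uw // wE // enorm_ge0.
have vs := laplacian_smooth (eball_open rho) us.
have vr := laplacian_radial i0 us ur.
(* The Laplacian of [laplacian u] equals [f (x, u x)], which is positive, so [laplacian u] is
   strictly subharmonic. *)
have v_incr p q : 0 <= p -> p < q -> q < rho ->
    laplacian u (p *: e) < laplacian u (q *: e).
  move=> p0 pq qr; apply: (subharmonic_profile_incr i0 vs vr) => // z z0 zq.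
  by rewrite u_eq //; apply: eball_axis => //; exact: lt_trans qr.
have u_gt0 p : 0 <= p -> p < rho -> 0 < u (p *: e).
  by move=> p0 pr; apply: u_pos; exact: eball_axis.
have u0 : u (rho *: e) = 0 by apply: u_bd; rewrite /esphere /= enorm_axis // ltW.
(* The endpoint [t = rho] is settled by the boundary value: [u] vanishes there and is positive at
   [s e]. *)
move: tr; rewrite le_eqVlt => /predU1P[tE|tr].
  by rewrite tE u0 u_gt0 // -tE.
rewrite ltNge; apply/negP => u_st.
have sr := lt_trans st tr.
have [c /[!in_itv] /= /andP[sc cr] cmax] :=
  EVT_max (ltW sr) (axis_within_continuous i0 hrho s0 uc).
(* The maximum must be moved off the endpoints. If it occurs at [s], then [t] attains it too, as
   [u (s e) <= u (t e)]; it cannot occur at [rho], where [u] is [0] but [u (s e) > 0]. *)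
have [d [sd dr dmax]] : exists d, [/\ s < d, d < rho &
    forall q, s <= q -> q <= rho -> u (q *: e) <= u (d *: e)].
  have {}cmax q : s <= q -> q <= rho -> u (q *: e) <= u (c *: e).
    by move=> sq qr; apply: cmax; rewrite in_itv /= sq qr.
  move: sc; rewrite le_eqVlt => /predU1P[sE|sc].
    exists t; split=> // q sq qr; apply: le_trans u_st.
    by rewrite sE; exact: cmax.
  exists c; split=> //; rewrite lt_neqAle cr andbT; apply/eqP => cE.
  have := cmax s (lexx _) (ltW sr); rewrite cE u0 leNgt u_gt0 //.
have d0 := le_lt_trans s0 sd.
have vd : laplacian u (d *: e) <= 0.
  apply: (laplacian_profile_max i0 us ur d (ltW d0) dr).
  apply: filterS2 (lt_nbhsr sd) (lt_nbhsl dr) => q sq qr _.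
  by apply: dmax; exact: ltW.
(* Maximality gives [u (s e) <= u (d e)], whereas [laplacian u < 0] on the axis before [d] gives the
   reverse strict inequality. *)
have := dmax s (lexx _) (ltW sr); rewrite leNgt => /negP; apply.
apply: (superharmonic_profile_decr i0 us ur s d s0 sd dr) => p p0 pd.
exact: lt_le_trans (v_incr p d p0 pd dr) vd.
Qed.
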